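(* Let $q_1(\partial),q_2(\partial)\in\mathbb{C}[\partial]$ and $a_1,a_2,b_1,b_2\in\mathbb{C}$. Then $M_{q_1(\partial),a_1,b_1}\cong M_{q_2(\partial),a_2,b_2}$ as generalized conformal modules over $Vir$ if and only if $$q_1(\partial)-q_2(\partial)\in\mathbb{C},\qquad a_1=a_2,\qquad b_1=b_2.$$
   Context: The Virasoro conformal algebra is $Vir=\mathbb{C}[\partial]L$ with $[L_\lambda L]=(\partial+2\lambda)L$. A generalized conformal module $V$ over $Vir$ is a $\mathbb{C}[\partial]$-module with a linear map $L_\lambda:V\to V[[\lambda]]$ such that $L_\lambda(\partial v)=(\partial+\lambda)L_\lambda v$ and $L_\lambda(L_\mu v)-L_\mu(L_\lambda v)=(\lambda-\mu)L_{\lambda+\mu}v$ for all $v\in V$. An isomorphism is a bijective $\mathbb{C}[\partial]$-linear map $\phi$ with $\phi(L_\lambda v)=L_\lambda\phi(v)$ ($\phi$ applied coefficientwise in $\lambda$). For $q(\partial)\in\mathbb{C}[\partial]$ and $a,b\in\mathbb{C}$, $M_{q(\partial),a,b}=\mathbb{C}[\partial]v$ is the generalized conformal module over $Vir$, free of rank one over $\mathbb{C}[\partial]$, with $L_\lambda v=e^{q(\lambda+\partial)-q(\partial)}(\partial+a\lambda+b)v$, where $e^{q(\lambda+\partial)-q(\partial)}=\sum_{k\ge0}\frac{(q(\lambda+\partial)-q(\partial))^k}{k!}\in\mathbb{C}[\partial][[\lambda]]$. *)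

(* Defs.v *)
From HB Require Import structures.
From mathcomp Require Import all_boot all_order all_algebra.
From mathcomp Require Import polyXY reals.
From mathcomp Require Import complex ring.

Set Implicit Arguments.
Unset Strict Implicit.
Unset Printing Implicit Defensive.
Import Order.TTheory GRing.Theory Num.Theory.
Local Open Scope ring_scope.

(* A formal power series [\sum_n s_n lambda^n] in V[[lambda]] is the function
   [s : nat -> V]; an element [\sum_(m, n) s_(m, n) lambda^m mu^n] of
   V[[lambda, mu]] is a function [s : nat -> nat -> V], the exponent of lambda
   coming first. *)
Definition ser_mul_lambda (V : zmodType) (s : nat -> V) : nat -> V :=
  fun n => if n is n'.+1 then s n' else 0.

Definition ser2_mul_lambda (V : zmodType) (s : nat -> nat -> V) :
  nat -> nat -> V := fun m n => if m is m'.+1 then s m' n else 0.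

Definition ser2_mul_mu (V : zmodType) (s : nat -> nat -> V) :
  nat -> nat -> V := fun m n => if n is n'.+1 then s m n' else 0.

(* The series s(lambda + mu). *)
Definition ser_subst_add (V : zmodType) (s : nat -> V) : nat -> nat -> V :=
  fun m n => s (m + n)%N *+ 'C(m + n, m).

(* The product of two power series in lambda. *)
Definition ser_mul (A : pzRingType) (s t : nat -> A) : nat -> A :=
  fun n => \sum_(i < n.+1) s i * t (n - i)%N.

(* Generalized conformal modules over Vir.  The ring K[d] is [{poly K}], d being
   ['X]; [gcm_L v n] is the coefficient of lambda^n in L_lambda v. *)
Record gen_conf_module (K : numFieldType) := GenConfModule {
  gcm_car :> lmodType {poly K};
  gcm_L : gcm_car -> nat -> gcm_car;
  gcm_linear : forall (c : K) (u v : gcm_car) (n : nat),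
    gcm_L (c%:P *: u + v) n = c%:P *: gcm_L u n + gcm_L v n;
  (* L_lambda (d v) = (d + lambda) L_lambda v *)
  gcm_sesqui : forall (v : gcm_car) (n : nat),
    gcm_L ('X *: v) n = 'X *: gcm_L v n + ser_mul_lambda (gcm_L v) n;
  (* L_lambda (L_mu v) - L_mu (L_lambda v) = (lambda - mu) L_(lambda + mu) v *)
  gcm_jacobi : forall (v : gcm_car) (m n : nat),
    gcm_L (gcm_L v n) m - gcm_L (gcm_L v m) n =
      ser2_mul_lambda (ser_subst_add (gcm_L v)) m n
      - ser2_mul_mu (ser_subst_add (gcm_L v)) m n
}.

Definition gcm_iso (K : numFieldType) (V W : gen_conf_module K) : Prop :=
  exists phi : {linear V -> W},
    bijective phi /\ forall v n, phi (gcm_L v n) = gcm_L (phi v) n.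

Section RankOne.
Variable K : numFieldType.
Implicit Types (q f g : {poly K}) (a b : K).

(* In [{poly {poly K}}] the outer variable ['X] is lambda and ['Y = 'X%:P] is d,
   so that [poly_XaY q] is q(lambda + d) and [q%:P] is q(d). *)
Definition qdiff q : {poly {poly K}} := poly_XaY q - q%:P.

(* e^(q(lambda + d) - q(d)).  Since q(lambda + d) - q(d) is divisible by lambda,
   only the terms k <= n contribute to the coefficient of lambda^n; see
   [exp_qdiff_stable]. *)
Definition exp_qdiff q : nat -> {poly K} :=
  fun n => \sum_(k < n.+1) (k`!%:R^-1 : K) *: (qdiff q ^+ k)`_n.

(* L_lambda v = e^(q(lambda + d) - q(d)) (d + a lambda + b) v *)
Definition M_gen q a b : nat -> {poly K} :=
  ser_mul (exp_qdiff q)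
    (fun i => ('Y + a%:P%:P * 'X + b%:P%:P : {poly {poly K}})`_i).

(* L_lambda (f(d) v) = f(lambda + d) L_lambda v, as forced by
   L_lambda (d v) = (d + lambda) L_lambda v *)
Definition M_act q a b (f : {poly K}^o) : nat -> {poly K}^o :=
  ser_mul (fun i => (poly_XaY f)`_i) (M_gen q a b).

Lemma qdiff0 q : (qdiff q)`_0 = 0.
Proof.
rewrite coefB coefC /= -horner_coef0 horner_poly_XaY add0r comp_polyXr.
exact: subrr.
Qed.

Lemma coef_qdiffX q k n : (n < k)%N -> (qdiff q ^+ k)`_n = 0.
Proof.
elim: k n => // k IH n; rewrite ltnS => le_nk.
rewrite exprSr coefM big_ord_recr /= subnn qdiff0 mulr0 addr0.
by rewrite big1 // => i _; rewrite IH ?mul0r // (leq_trans (ltn_ord i)).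
Qed.

(* The exponential truncated at order N. *)
Definition expq q N : {poly {poly K}} :=
  \sum_(k < N) (k`!%:R^-1 : K)%:P%:P * qdiff q ^+ k.

Lemma exp_qdiff_stable q n N : (n < N)%N ->
  exp_qdiff q n = \sum_(k < N) (k`!%:R^-1 : K) *: (qdiff q ^+ k)`_n.
Proof.
move=> lt_nN; rewrite /exp_qdiff.
rewrite -!(big_mkord xpredT (fun k => (k`!%:R^-1 : K) *: (qdiff q ^+ k)`_n)).
rewrite (big_cat_nat (n := n.+1) (p := N)) //= [X in _ = _ + X]big1_seq ?addr0 //.
move=> k /=; rewrite mem_index_iota => /andP[le_nk _].
by rewrite coef_qdiffX // scaler0.
Qed.

Lemma coef_expq q n N : (n < N)%N -> (expq q N)`_n = exp_qdiff q n.
Proof.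
move=> lt_nN; rewrite (exp_qdiff_stable _ lt_nN) coef_sum.
by apply: eq_bigr => k _; rewrite coefCM mul_polyC.
Qed.

(* The derivative with respect to d, coefficientwise in lambda. *)
Definition dY (P : {poly {poly K}}) := map_poly (@deriv K) P.

Lemma coef_dY P i : (dY P)`_i = (P`_i)^`().
Proof. by rewrite coef_map_id0 ?deriv0. Qed.

Lemma dYD P Q : dY (P + Q) = dY P + dY Q.
Proof. by apply/polyP=> i; rewrite coefD !coef_dY coefD derivD. Qed.

Lemma dYC f : dY f%:P = f^`()%:P.
Proof. by apply/polyP=> i; rewrite coef_dY !coefC; case: ifP; rewrite ?deriv0. Qed.

Lemma dYM P Q : dY (P * Q) = dY P * Q + P * dY Q.
Proof.
apply/polyP=> i; rewrite coefD !coefM coef_dY coefM raddf_sum /= -big_split /=.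
by apply: eq_bigr => j _; rewrite derivM !coef_dY.
Qed.

Lemma dY_XaY f : dY (poly_XaY f) = (poly_XaY f)^`().
Proof.
elim/poly_ind: f => [|f c IH].
  by rewrite poly_XaY0 deriv0; apply/polyP=> i; rewrite coef_dY coef0 deriv0.
rewrite /poly_XaY rmorphD rmorphM /= map_polyX map_polyC /=.
rewrite comp_polyD comp_polyM comp_polyX comp_polyC -/(poly_XaY f).
rewrite dYD dYM IH !derivE dYC !derivE dYD dYC derivX.
rewrite (_ : dY 'X = 0) ?add0r ?addr0 //.
apply/polyP=> i; rewrite coef_dY coefX coef0.
by case: eqP; rewrite ?deriv0 // -[1%:R]/(1%:P) derivC.
Qed.

Definition delta P := P^`() - dY P.

Lemma deltaD P Q : delta (P + Q) = delta P + delta Q.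
Proof. by rewrite /delta derivD dYD; ring. Qed.

Lemma deltaM P Q : delta (P * Q) = delta P * Q + P * delta Q.
Proof. by rewrite /delta derivM dYM; ring. Qed.

Lemma delta_XaY f : delta (poly_XaY f) = 0.
Proof. by rewrite /delta dY_XaY subrr. Qed.

Lemma deltaC (c : K) : delta c%:P%:P = 0.
Proof. by rewrite /delta dYC !derivC subr0. Qed.

Lemma delta1 : delta 1 = 0.
Proof. exact: (deltaC 1). Qed.

Lemma delta_qdiff q : delta (qdiff q) = q^`()%:P.
Proof.
rewrite /qdiff deltaD delta_XaY add0r /delta -polyCN dYC !derivE.
by rewrite sub0r polyCN opprK.
Qed.

Lemma delta_qdiffX q k : delta (qdiff q ^+ k.+1) = k.+1%:R * q^`()%:P * qdiff q ^+ k.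
Proof.
elim: k => [|k IH]; first by rewrite expr1 delta_qdiff mulr1 mul1r.
by rewrite exprS deltaM IH delta_qdiff [qdiff q ^+ k.+1]exprS; ring.
Qed.

Lemma delta_expq q N : delta (expq q N.+1) = q^`()%:P * expq q N.
Proof.
elim: N => [|N IH].
  rewrite /expq big_ord_recl !big_ord0 mulr0 addr0 expr0 deltaM deltaC.
  by rewrite delta1 !(mulr0, mul0r) addr0.
rewrite {1}/expq big_ord_recr /= -/(expq q N.+1) deltaD IH.
rewrite [in RHS]/expq big_ord_recr /= -/(expq q N) mulrDr; congr (_ + _).
rewrite deltaM deltaC mul0r add0r delta_qdiffX.
rewrite factS natrM invfM 2!polyCM.
have -> : N.+1%:R = (N.+1%:R : K)%:P%:P :> {poly {poly K}}.
  by rewrite !rmorph_nat.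
rewrite [LHS](_ : _ = ((N.+1%:R : K)^-1%:P%:P * (N.+1%:R : K)%:P%:P)
  * (q^`()%:P * ((N`!%:R^-1 : K)%:P%:P * qdiff q ^+ N))); last by ring.
by rewrite -2!polyCM mulVf ?pnatr_eq0 // mul1r.
Qed.

(* [expshift q f] is f(lambda + d) e^(q(lambda + d) - q(d)). *)
Definition expshift q f : nat -> {poly K} :=
  ser_mul (fun i => (poly_XaY f)`_i) (exp_qdiff q).

Lemma expshiftE q f n N : (n < N)%N ->
  expshift q f n = (poly_XaY f * expq q N)`_n.
Proof.
move=> lt_nN; rewrite coefM; apply: eq_bigr => i _.
by rewrite coef_expq // (leq_ltn_trans (leq_subr _ _)).
Qed.

Definition twist q f := f^`() + q^`() * f.

Lemma expshiftS q f n :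
  expshift q f n.+1 *+ n.+1 = twist q (expshift q f n).
Proof.
rewrite (@expshiftE _ _ n.+1 n.+2) // -coef_deriv.
have := deltaM (poly_XaY f) (expq q n.+2).
rewrite delta_XaY mul0r add0r delta_expq => /eqP; rewrite subr_eq => /eqP ->.
rewrite coefD coef_dY mulrCA coefCM -!expshiftE // addrC.
by [].
Qed.

Lemma expshift0 q f : expshift q f 0 = f.
Proof.
rewrite /expshift /ser_mul big_ord1 /exp_qdiff big_ord1 fact0 invr1 scale1r expr0.
by rewrite coef1 mulr1 -horner_coef0 horner_poly_XaY add0r comp_polyXr.
Qed.

(* e^(- q) (d/dd)^n e^q / n!, the coefficient of lambda^n in
   f |-> f(lambda + d) e^(q(lambda + d) - q(d)). *)
Definition tw q n f : {poly K} := (n`!%:R^-1 : K) *: iter n (twist q) f.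

Lemma twistZ q (c : K) f : twist q (c *: f) = c *: twist q f.
Proof. by rewrite /twist derivZ scalerDr scalerAr. Qed.

Lemma twistMn q f n : twist q (f *+ n) = twist q f *+ n.
Proof. by rewrite /twist derivMn mulrnAr mulrnDl. Qed.

Lemma twistD q f g : twist q (f + g) = twist q f + twist q g.
Proof. by rewrite /twist derivD mulrDr; ring. Qed.

Lemma iter_twistZ q n (c : K) f :
  iter n (twist q) (c *: f) = c *: iter n (twist q) f.
Proof. by elim: n => //= n ->; rewrite twistZ. Qed.

Lemma iter_twistD q n f g :
  iter n (twist q) (f + g) = iter n (twist q) f + iter n (twist q) g.
Proof. by elim: n => //= n ->; rewrite twistD. Qed.

Lemma expshift_tw q f n : expshift q f n = tw q n f.
Proof.
elim: n => [|n IH]; first by rewrite expshift0 /tw fact0 invr1 scale1r.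
have nz : (n.+1%:R : K) != 0 by rewrite pnatr_eq0.
apply: (scalerI nz); rewrite scaler_nat expshiftS IH /tw iterS twistZ.
by rewrite scalerA factS natrM invfM mulrA mulfV // mul1r.
Qed.

Lemma twD q n f g : tw q n (f + g) = tw q n f + tw q n g.
Proof. by rewrite /tw iter_twistD scalerDr. Qed.

Lemma twZ q n (c : K) f : tw q n (c *: f) = c *: tw q n f.
Proof. by rewrite /tw iter_twistZ !scalerA mulrC. Qed.

Lemma tw_tw q m n f : tw q m (tw q n f) = tw q (m + n) f *+ 'C(m + n, m).
Proof.
rewrite /tw iter_twistZ scalerA -iterD -scaler_nat scalerA; congr (_ *: _).
rewrite -(@bin_fact (m + n) m) ?leq_addr // addKn !natrM !invfM.
have nz k : (k`!%:R : K) != 0 by rewrite pnatr_eq0 -lt0n fact_gt0.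
have nzb : ('C(m + n, m)%:R : K) != 0.
  by rewrite pnatr_eq0 -lt0n bin_gt0 leq_addr.
by field; rewrite nzb !nz.
Qed.

Definition twp q n f : {poly K} := if n is n'.+1 then tw q n' f else 0.

Lemma tw_X q n f : tw q n ('X * f) = 'X * tw q n f + twp q n f.
Proof.
have it k : iter k (twist q) ('X * f)
    = 'X * iter k (twist q) f + iter k.-1 (twist q) f *+ k.
  elim: k => [|k IH]; first by rewrite mulr0n addr0.
  rewrite !iterS IH twistD.
  have -> : twist q (iter k.-1 (twist q) f *+ k) = iter k (twist q) f *+ k.
    case: k {IH} => [|k]; last by rewrite twistMn.
    by rewrite !mulr0n /twist deriv0 mulr0 addr0.
  by rewrite /= mulrSr /twist derivM derivX; ring.
rewrite /tw it; case: n => [|n] /=; first by rewrite mulr0n !addr0 scalerAr.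
rewrite scalerDr scalerAr; congr (_ + _).
rewrite -scaler_nat scalerA /tw; congr (_ *: _).
by rewrite factS natrM invfM mulrAC mulVf ?mul1r // pnatr_eq0.
Qed.

Lemma twpD q n f g : twp q n (f + g) = twp q n f + twp q n g.
Proof. by case: n => [|n] /=; rewrite ?addr0 ?twD. Qed.

Lemma twpZ q n (c : K) f : twp q n (c *: f) = c *: twp q n f.
Proof. by case: n => [|n] /=; rewrite ?scaler0 ?twZ. Qed.

Lemma ser_mulA (s t u : nat -> {poly K}) n :
  ser_mul s (ser_mul t u) n = ser_mul (ser_mul s t) u n.
Proof.
have tr (v : nat -> {poly K}) m : (m <= n)%N -> v m = (\poly_(i < n.+1) v i)`_m.
  by move=> le_mn; rewrite coef_poly ltnS le_mn.
have sm (v w : nat -> {poly K}) m : (m <= n)%N ->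
    ser_mul v w m = ((\poly_(i < n.+1) v i) * (\poly_(i < n.+1) w i))`_m.
  move=> le_mn; rewrite coefM; apply: eq_bigr => i _.
  by rewrite -!tr // ?(leq_trans (leq_subr _ _)) // (leq_trans (leq_ord i)).
transitivity ((\poly_(i < n.+1) s i) *
    ((\poly_(i < n.+1) t i) * (\poly_(i < n.+1) u i)))`_n.
  rewrite coefM; apply: eq_bigr => i _; rewrite -sm ?leq_subr // -tr //.
  exact: leq_ord.
rewrite mulrA coefM; apply: eq_bigr => i _; rewrite -sm ?leq_ord // -tr //.
exact: leq_subr.
Qed.

Lemma M_actE q a b f n :
  M_act q a b f n = ('X + b%:P) * tw q n f + a *: twp q n f.
Proof.
rewrite /M_act /M_gen ser_mulA -/(expshift q f) /ser_mul.
under eq_bigr do rewrite expshift_tw !coefD coefMX !coefC.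
case: n => [|n].
  rewrite big_ord1 /= scaler0; ring.
rewrite 2!big_ord_recr /= subnn subSnn /= big1 ?add0r => [|i _].
  by rewrite -mul_polyC; ring.
have -> : (n.+1 - i = (n - i).-1.+2)%N.
  by rewrite prednK ?subn_gt0 // subSn // ltnW.
by rewrite /= !addr0 mulr0.
Qed.

Lemma M_act_gen q a b n : M_act q a b 1 n = M_gen q a b n.
Proof.
have XaY1 : poly_XaY (1 : {poly K}) = 1.
  by rewrite /poly_XaY rmorph1 -[1]/(1%:P) comp_polyC.
rewrite /M_act /ser_mul big_ord_recl XaY1 coef1 mul1r subn0 big1 ?addr0 // => i _.
by rewrite coef1 mul0r.
Qed.

Lemma M_act_linear q a b (c : K) (u v : {poly K}^o) n :
  M_act q a b (c%:P *: u + v) n = c%:P *: M_act q a b u n + M_act q a b v n.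
Proof.
have -> : c%:P *: u = (c *: (u : {poly K})) by rewrite -mul_polyC.
rewrite !M_actE twD twpD twZ twpZ -[c%:P *: _]/(c%:P * _) -!mul_polyC; ring.
Qed.

Lemma M_act_sesqui q a b (v : {poly K}^o) n :
  M_act q a b ('X *: v) n
  = 'X *: M_act q a b v n + ser_mul_lambda (M_act q a b v) n.
Proof.
rewrite -['X *: v]/('X * v) -['X *: M_act _ _ _ _ _]/('X * _) !M_actE tw_X.
case: n => [|n] /=; first by rewrite !scaler0 !addr0; ring.
by rewrite M_actE tw_X -!mul_polyC; ring.
Qed.

Lemma M_act_jacobi q a b (v : {poly K}^o) m n :
  M_act q a b (M_act q a b v n) m - M_act q a b (M_act q a b v m) n =
    ser2_mul_lambda (ser_subst_add (M_act q a b v)) m n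
    - ser2_mul_mu (ser_subst_add (M_act q a b v)) m n.
Proof.
have twX k g h : tw q k (('X + b%:P) * g + a%:P * h) =
    ('X + b%:P) * tw q k g + twp q k g + a%:P * tw q k h.
  by rewrite twD !mul_polyC twZ mulrDl twD tw_X mul_polyC twZ -!mul_polyC; ring.
have twpX k g h : twp q k (('X + b%:P) * g + a%:P * h) =
    ('X + b%:P) * twp q k g + twp q k.-1 g + a%:P * twp q k h.
  case: k => [|k] /=; last exact: twX.
  by rewrite !mulr0 !addr0.
have binC i j : 'C(i + j, i) = 'C(i + j, j).
  by have := bin_sub (leq_addl i j); rewrite addnK.
have twC i j g : tw q i (tw q j g) = tw q j (tw q i g).
  by rewrite !tw_tw binC addnC.
have twpt i j g : twp q i (tw q j.+1 g) = tw q (i + j) g *+ 'C(i + j, j.+1).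
  case: i => [|i] /=; first by rewrite bin_small ?mulr0n.
  rewrite tw_tw addSnnS; congr (_ *+ _).
  exact: binC.
have tw0 g : tw q 0 g = g by rewrite /tw fact0 invr1 scale1r.
have twp0 g : twp q 0 g = 0 by [].
have twpS k g : twp q k.+1 g = tw q k g by [].
have tt i j g := tw_tw q i j g.
have tw00 k : tw q k 0 = 0 by rewrite -(scale0r (0 : {poly K})) twZ !scale0r.
have LE k g : M_act q a b g k = ('X + b%:P) * tw q k g + a%:P * twp q k g.
  by rewrite M_actE mul_polyC.
rewrite /ser2_mul_lambda /ser2_mul_mu /ser_subst_add.
move: (tw q) (twp q) (M_act q a b) twX twpX twC twpt tw0 tw00 twp0 twpS tt LE.
move=> t tp L tX tpX tC tpt t0 tz tp0 tpS tt LE.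
rewrite !LE; case: m n => [|m] [|n].
- by rewrite !subrr.
- by rewrite add0n bin0 mulr1n !LE !tX !tpX /= !tpS !t0 !tp0 !tz; ring.
- by rewrite addn0 binn mulr1n !LE !tX !tpX /= !tpS !t0 !tp0 !tz; ring.
rewrite !LE !tX !tpX /= !tpS (tC n.+1 m.+1) (tC n.+1 m) (tC n m.+1) (tC n m).
rewrite !tpt (addnC n m) !tt addSn addnS /= !tpS.
have -> : 'C((m + n).+1, m) = ('C(m + n, n.+1) + 'C(m + n, m))%N.
  by rewrite -addnS binC addnS binS -(binC m n).
by rewrite binS !mulrnDr; ring.
Qed.

(* M_(q, a, b) is the regular module {poly K}^o, free on v = 1; see
   [M_act_gen]. *)
Definition M_mod q a b : gen_conf_module K :=
  GenConfModule (@M_act_linear q a b) (@M_act_sesqui q a b)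
    (@M_act_jacobi q a b).

End RankOne.

(* Main.v *)
Require Import Defs.
From mathcomp Require Import all_boot all_order all_algebra.
From mathcomp Require Import reals.
From mathcomp Require Import complex ring.
Import GRing.Theory Num.Theory.
Local Open Scope ring_scope.

(* An isomorphism is multiplication by a unit of the polynomial ring, i.e. by a
   nonzero constant, so it exists iff the two generators have the same action.
   The coefficients of lambda^0 and lambda^1 of [L_lambda v] are [d + b] and
   [(d + b) q' + a]: the former determines [b], the value of the latter at
   [d = - b] determines [a], and then [q'] is determined, i.e. [q] up to a
   constant.  Conversely the action only involves [q] through [q']. *)

(** In characteristic zero, the coefficient (n + 1) p_(n + 1) of p' vanishes only if p_(n + 1)
    does. *)
Lemma deriv_eq0_const (K : numFieldType) (p : {poly K}) :
  p^`() = 0 -> p = (p`_0)%:P.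
Proof.
move=> dp0; apply/polyP=> -[|n]; rewrite coefC //=.
have /eqP := congr1 (fun r : {poly K} => r`_n) dp0.
by rewrite coef_deriv coef0 mulrn_eq0 => /eqP.
Qed.

Lemma M_act1_0 (K : numFieldType) (q : {poly K}) (a b : K) :
  M_act q a b 1 0 = 'X + b%:P.
Proof.
by rewrite M_actE /tw /= fact0 invr1 scale1r mulr1 scaler0 addr0.
Qed.

Lemma M_act1_1 (K : numFieldType) (q : {poly K}) (a b : K) :
  M_act q a b 1 1 = ('X + b%:P) * q^`() + a%:P.
Proof.
rewrite M_actE /twp /tw /twist /= fact0 factS fact0 muln1 invr1 !scale1r.
by rewrite derivC add0r mulr1 alg_polyC.
Qed.

Lemma M_act1_inj (K : numFieldType) (q1 q2 : {poly K}) (a1 a2 b1 b2 : K) :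
  M_act q1 a1 b1 1 =1 M_act q2 a2 b2 1 ->
  [/\ exists c, q1 - q2 = c%:P, a1 = a2 & b1 = b2].
Proof.
move=> eqM; have := eqM 0; have := eqM 1.
rewrite !M_act1_0 !M_act1_1 => eq1 /addrI/polyC_inj eqb.
subst b2.
have eqa : a1 = a2.
  by have := congr1 (horner^~ (- b1)) eq1; rewrite !hornerE addNr !mul0r !add0r.
split=> //; exists (q1 - q2)`_0; apply: deriv_eq0_const.
(* Cancelling the factor ['X + b1%:P], nonzero since its size is 2, gives q1' = q2'. *)
move: eq1; rewrite derivB eqa => /addIr/mulfI -> //; first by rewrite subrr.
by rewrite -size_poly_eq0 size_XaddC.
Qed.

Lemma gcm_iso_M_act1 (K : numFieldType) (q1 q2 : {poly K}) (a1 a2 b1 b2 : K) :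
  gcm_iso (M_mod q1 a1 b1) (M_mod q2 a2 b2) ->
  M_act q1 a1 b1 1 =1 M_act q2 a2 b2 1.
Proof.
case=> phi [[psi phiK psiK] phiL] n.
set u : {poly K} := phi 1.
(* The scalars of the regular module are all of K[d], so [phi] is determined by [u]. *)
have phiE (f : {poly K}) : phi f = f * u.
  by rewrite /u -[f in LHS]mulr1 (linearZ_LR phi f 1).
have: u \is a GRing.unit.
  by apply/unitrPr; exists (psi 1); rewrite mulrC -phiE psiK.
rewrite poly_unitE => /andP[/size_poly1P[c c0 uE] _].
have := phiL 1 n; rewrite !phiE mul1r uE /=.
(* The action is K-linear but not K[d]-linear: it matters that [u] is a constant. *)
have -> : M_act q2 a2 b2 c%:P n = M_act q2 a2 b2 1 n * c%:P.
  by rewrite !M_actE -(alg_polyC c) twZ twpZ -!mul_polyC; ring.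
by apply: mulIf; rewrite polyC_eq0.
Qed.

(** By [M_actE], q enters the action only through [twist], where it occurs as q'. *)
Lemma M_act_deriv (K : numFieldType) (q1 q2 : {poly K}) (a b : K) f n :
  q1^`() = q2^`() -> M_act q1 a b f n = M_act q2 a b f n.
Proof.
move=> eqq; have eqtw k g : tw q1 k g = tw q2 k g.
  by rewrite /tw; congr (_ *: _); apply: eq_iter => h; rewrite /twist eqq.
by rewrite !M_actE eqtw; case: n => //= n; rewrite eqtw.
Qed.

Theorem proposition3p15 (R : realType) (q1 q2 : {poly R[i]})
    (a1 a2 b1 b2 : R[i]) :
  gcm_iso (M_mod q1 a1 b1) (M_mod q2 a2 b2) <->
  [/\ exists c : R[i], q1 - q2 = c%:P, a1 = a2 & b1 = b2].
Proof.
split=> [/gcm_iso_M_act1/M_act1_inj // | [[c eqq] -> ->]].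
(* The two actions coincide, so the identity is an isomorphism. *)
exists idfun; split=> [|v n]; first by exists id.
apply: M_act_deriv; apply/eqP.
by rewrite -subr_eq0 -derivB eqq derivC.
Qed.
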